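(* Let $t=\{t_k\}_{k=1}^\infty$ be a non-increasing sequence of positive numbers, $1\le q<\infty$ and $0<p\le q$. If $0\le\varepsilon\le t_1$, then $$\mathcal{E}\left(W^T_q,I_{\varepsilon,p}\right)=\mathcal{E}\left(W^T_q,I_{\varepsilon,p},\mathrm{id}\right)=\varepsilon,$$ and if $\varepsilon>t_1$, then $$\mathcal{E}\left(W^T_q,I_{\varepsilon,p}\right)=\mathcal{E}\left(W^T_q,I_{\varepsilon,p},\Phi^*_0\right)=t_1.$$
   Context: $\ell_q$ is the space of complex sequences $x=\{x_k\}_{k=1}^\infty$ with the usual norm $\|x\|_q$. The class is $W^T_q=\{x=Th : h\in\ell_q,\ \|h\|_q\le 1\}$, where $Th=\{t_kh_k\}_{k=1}^\infty$. Let $Z$ be a complex linear space, $W\subset\ell_q$, and let $I$ be an information mapping assigning to each $x\in\ell_q$ a non-empty subset $I(x)\subset Z$. A method of recovery is an arbitrary mapping $\Phi:Z\to\ell_q$. Its error is $\mathcal{E}(W,I,\Phi)=\sup_{x\in W}\sup_{a\in I(x)}\|x-\Phi(a)\|_q$, and the error of optimal recovery is $\mathcal{E}(W,I)=\inf_{\Phi}\mathcal{E}(W,I,\Phi)$, the infimum being over all methods $\Phi:Z\to\ell_q$. Here $I_{\varepsilon,p}(x)=x+B[\varepsilon,\ell_p]$, where $B[\varepsilon,\ell_p]=\{y:(\sum_{k=1}^\infty|y_k|^p)^{1/p}\le\varepsilon\}$. Since $p\le q$, $I_{\varepsilon,p}(x)\subset\ell_q$ for $x\in\ell_q$, and one takes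 $Z=\ell_q$. The method $\mathrm{id}$ is the identity mapping $\mathrm{id}(a)=a$, and $\Phi^*_0(a)$ is the zero sequence for every $a$. *)

(* Defs.v *)
From HB Require Import structures.
From mathcomp Require Import all_boot all_order all_algebra.
From mathcomp Require Import all_classical all_reals all_analysis.
From mathcomp Require Export complex.
Set Implicit Arguments.
Unset Strict Implicit.
Unset Printing Implicit Defensive.
Import Order.TTheory GRing.Theory Num.Theory.
Import numFieldNormedType.Exports.
Local Open Scope classical_set_scope.
Local Open Scope ring_scope.
Local Open Scope ereal_scope.
Local Open Scope complex_scope.
Local Open Scope ring_scope.

(* Sequences are indexed from 0, so the first term t_1 is [t 0%N].  The
   codomain is the regular module [R[i]^o] because [R[i]] itself carries a
   module structure over [R]. *)
Notation cseq R := (nat -> R[i]^o).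

Section SequenceSpaces.
Context {R : realType}.
Local Notation normc := (@ComplexField.Normc.normc R).
Implicit Types (p q eps : R).

Definition lpnorm p (x : cseq R) : \bar R :=
  ('N[counting]_(p%:E)[EFin \o normc \o x])%E.

Lemma lpnormE p (x : cseq R) : 0 < p ->
  lpnorm p x =
    ((\sum_(k <oo) (normc (x k) `^ p)%:E) `^ p^-1)%E.
Proof.
move=> p0; rewrite /lpnorm Lnorm_counting//; congr (_ `^ _)%E.
apply: eq_eseriesr => k _; rewrite abse_EFin poweR_EFin.
by rewrite ger0_norm//; case: (x k) => a b; exact: sqrtr_ge0.
Qed.

Definition lpball p eps : set (cseq R) := [set y : cseq R | (lpnorm p y <= eps%:E)%E].

Definition ell_pred q (q1 : 1 <= q) : {pred cseq R} :=
  [pred x | (lpnorm q x < +oo)%E].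

Section EllSpace.
Context (q : R) (q1 : 1 <= q).

Lemma ell_submod_closed : submod_closed (ell_pred q1).
Proof.
have q0 : 0 < q by apply: lt_le_trans q1.
have normc_ge0 (z : R[i]) : 0 <= normc z.
  by case: z => a b; exact: sqrtr_ge0.
split=> [|a x y xq yq].
  rewrite inE /lpnorm (@eq_Lnorm _ _ _ _ _ _ (cst 0%E)) ?Lnorm0 ?ltry//.
    by rewrite eqe gt_eqF.
  by move=> k; exact: (congr1 EFin (ComplexField.Normc.normc0 R)).
pose f k := normc (x k) : R.
pose g k := normc (y k) : R.
pose c := normc a : R.
have fE : ('N[counting]_(q%:E)[EFin \o f] < +oo)%E by exact: xq.
have gE : ('N[counting]_(q%:E)[EFin \o g] < +oo)%E by exact: yq.
have cfE : ('N[counting]_(q%:E)[EFin \o (fun k => c * f k)%R] < +oo)%E.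
  have q1E : (1 <= q%:E)%E by rewrite lee_fin.
  have Pf : (f : nat -> R) \in @Lfun _ nat R counting q%:E.
    by apply/andP; split; rewrite inE.
  pose F := Sub f Pf : LfunType (@counting nat R) q1E.
  have := LnormZ F c; rewrite /F /= => E.
  apply: (@le_lt_trans _ _ (`|c|%:E * 'N[counting]_(q%:E)[EFin \o f])%E).
    by rewrite -E.
  by rewrite lte_mul_pinfty// lee_fin.
rewrite inE /lpnorm.
apply: (@le_lt_trans _ _
    'N[counting]_(q%:E)[EFin \o ((fun k => c * f k) \+ g)%R]%E).
  rewrite !Lnorm_counting//.
  apply: gt0_ler_poweR.
  - by rewrite invr_ge0 ltW.
  - by rewrite in_itv/= leey andbT nneseries_ge0// => k _ _; exact: poweR_ge0.
  - by rewrite in_itv/= leey andbT nneseries_ge0// => k _ _; exact: poweR_ge0.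
  apply: lee_nneseries => [k _ _|k _]; first exact: poweR_ge0.
  rewrite !abse_EFin !poweR_EFin lee_fin ge0_ler_powR ?(ltW q0) ?nnegrE//.
  have f0 : 0 <= f k by exact: normc_ge0.
  have g0 : 0 <= g k by exact: normc_ge0.
  have c0 : 0 <= c by exact: normc_ge0.
  rewrite !ger0_norm ?addr_ge0 ?mulr_ge0 ?normc_ge0//.
  apply: le_trans (le_normcD _ _) _.
  by rewrite ComplexField.Normc.normcM.
apply: le_lt_trans (minkowski_EFin _ _ _ _) _ => //.
exact: lte_add_pinfty.
Qed.

HB.instance Definition _ :=
  GRing.isSubmodClosed.Build _ _ (ell_pred q1) ell_submod_closed.

Record ell := Ell { ell_val :> cseq R ; _ : ell_val \in ell_pred q1 }.

HB.instance Definition _ := [isSub for ell_val].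
HB.instance Definition _ := [Choice of ell by <:].
HB.instance Definition _ := [SubChoice_isSubLmodule of ell by <:].

Section Recovery.
Context (Z : lmodType R[i]).

Definition method_error (W : set ell) (I : ell -> set Z) (Phi : Z -> ell)
    : \bar R :=
  ereal_sup [set e | exists x, W x /\
    exists a, I x a /\ e = lpnorm q (x - Phi a : ell)].

Definition optimal_error (W : set ell) (I : ell -> set Z) : \bar R :=
  ereal_inf [set method_error W I Phi | Phi in [set: Z -> ell]].

End Recovery.

Definition diag_op (t : nat -> R) (h : cseq R) : cseq R :=
  fun k => (t k)%:C * h k.

Definition class_W (t : nat -> R) : set ell :=
  [set x | exists2 h : ell, (lpnorm q h <= 1)%E & ell_val x = diag_op t h].

(* [x + B[eps, l_p]]; for [0 < p <= q] every element of this translate lies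
   in [l_q], so viewing it as a set of points of [ell] loses nothing. *)
Definition info_ball p eps (x : ell) : set ell :=
  [set a | exists2 y, lpball p eps y & ell_val a = ell_val x + y].

Lemma info_ball_nonempty p eps x : 0 < p -> 0 <= eps ->
  info_ball p eps x !=set0.
Proof.
move=> p0 e0; exists x; exists 0; last by rewrite addr0.
rewrite /lpball/= /lpnorm (@eq_Lnorm _ _ _ _ _ _ (cst 0%E)) ?Lnorm0 ?lee_fin//.
  by rewrite eqe gt_eqF.
by move=> k; exact: (congr1 EFin (ComplexField.Normc.normc0 R)).
Qed.

End EllSpace.
End SequenceSpaces.

Arguments ell {R q} q1.
Arguments class_W {R q} q1 t.
Arguments info_ball {R q} q1 p eps x.

(* Main.v *)
Require Import Defs.
From mathcomp Require Import all_boot all_order all_algebra.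
From mathcomp Require Import all_classical all_reals all_analysis.
From mathcomp Require Import lra.

(** Both regimes say that the error of optimal recovery is the smaller of eps
    and the first multiplier t 0, with an explicit method attaining it.

    Lower bound ([optimal_error_ge]).  For c at most both eps and t 0, let s be
    the sequence with c in position 0 and zeros elsewhere.  Then s and - s both
    lie in the class, because c / t 0 has modulus at most 1, and both are
    compatible with the observation 0, because their l_p norm is at most eps.
    Any method answers 0 with one sequence z, whose distances to s and to - s
    add up to at least 2 c already in coordinate 0; so one of them is at least c.

    Upper bounds.  The identity errs by the noise itself, whose l_q norm is at
    most its l_p norm since p <= q ([lpnorm_anti], [method_error_id_le]).  The
    zero method errs by the norm of x = T h, which is at most t 0 because t 0
    dominates all the multipliers ([method_error_zero_le]).

    Since the optimal error is at most the error of each method, each upper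
    bound that meets the lower bound forces two equalities. *)
Set Implicit Arguments.
Unset Strict Implicit.
Unset Printing Implicit Defensive.
Import Order.TTheory GRing.Theory Num.Theory.
Local Open Scope classical_set_scope.
Local Open Scope ring_scope.

Section SequenceNorms.
Context {R : realType}.
Local Notation normc := (@ComplexField.Normc.normc R).
Implicit Types (p q c : R) (x y : cseq R).

Lemma normc_ge0 (z : R[i]) : 0 <= normc z.
Proof. by case: z => a b; exact: sqrtr_ge0. Qed.

Lemma normc_real c : normc (c%:C)%C = `|c|.
Proof. by rewrite /= expr0n addr0 sqrtr_sqr. Qed.

(** Replacing a bound on the norm by a bound on a series of nonnegative terms
    removes the outer root, so that the comparisons below are termwise. *)
Lemma lpnorm_leE p c x : 0 < p -> 0 <= c ->
  (lpnorm p x <= c%:E)%E =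
  (\sum_(0 <= k <oo) (normc (x k) `^ p)%:E <= (c `^ p)%:E)%E.
Proof.
move=> p0 c0; rewrite lpnormE//; set S := (\sum_(0 <= k <oo) _)%E.
have S0 : (0 <= S)%E by apply: nneseries_ge0 => k _ _; rewrite lee_fin powR_ge0.
apply/idP/idP => h.
- have {h} := @gt0_ler_poweR _ p (ltW p0) (S `^ p^-1)%E c%:E _ _ h.
  rewrite -poweRrM mulVf ?gt_eqF// poweRe1// poweR_EFin; apply.
  + by rewrite in_itv/= poweR_ge0 leey.
  + by rewrite in_itv/= lee_fin c0 leey.
- have p'0 : 0 <= p^-1 by rewrite invr_ge0 ltW.
  have {h} := @gt0_ler_poweR _ p^-1 p'0 S (c `^ p)%:E _ _ h.
  rewrite poweR_EFin -powRrM mulfV ?gt_eqF// powRr1//; apply.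
  + by rewrite in_itv/= S0 leey.
  + by rewrite in_itv/= lee_fin powR_ge0 leey.
Qed.

Lemma lpnorm_ge0 p x : (0 <= lpnorm p x)%E.
Proof. exact: Lnorm_ge0. Qed.


Lemma normc_le_lpnorm p x k : 0 < p -> ((normc (x k))%:E <= lpnorm p x)%E.
Proof.
move=> p0; have := lpnorm_ge0 p x.
case E : (lpnorm p x) => [c| |]; rewrite ?leey//.
rewrite !lee_fin => c0; move: (lexx (lpnorm p x)); rewrite {2}E lpnorm_leE// => h.
rewrite leNgt; apply/negP => cx.
have : c `^ p < normc (x k) `^ p.
  by apply: gt0_ltr_powR => //; rewrite nnegrE ?normc_ge0.
apply/negP; rewrite -leNgt -lee_fin; apply: le_trans h.
apply: le_trans (nneseries_lim_ge k.+1 _); last first.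
  by move=> n _ _; rewrite lee_fin powR_ge0.
rewrite big_nat_recr//= leeDr// sume_ge0// => i _.
by rewrite lee_fin powR_ge0.
Qed.

(** With c the l_p norm of x, every |x_k| is at most c, so that
    |x_k|^q <= c^(q-p) |x_k|^p, and summing gives c^(q-p) c^p = c^q. *)
Lemma lpnorm_anti p q x : 0 < p -> p <= q -> (lpnorm q x <= lpnorm p x)%E.
Proof.
move=> p0 pq; have q0 := lt_le_trans p0 pq; have := lpnorm_ge0 p x.
case E : (lpnorm p x) => [c| |]; rewrite ?leey//.
rewrite lee_fin => c0; move: (lexx (lpnorm p x)); rewrite {2}E lpnorm_leE// => h.
(* Holds at z = 0 too, where the degenerate exponent is excluded by q != 0. *)
have powD z : z `^ q = z `^ (q - p) * z `^ p.
  by rewrite -powRD subrK// (gt_eqF q0).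
rewrite lpnorm_leE// powD EFinM.
apply: le_trans (lee_wpmul2l _ h); last by rewrite lee_fin powR_ge0.
rewrite -nneseriesZl; last by move=> k _; rewrite lee_fin powR_ge0.
apply: lee_nneseries => [k _ _|k _]; first by rewrite lee_fin powR_ge0.
rewrite -EFinM lee_fin powD ler_wpM2r ?powR_ge0//.
apply: ge0_ler_powR; rewrite ?subr_ge0 ?nnegrE ?normc_ge0//.
by rewrite -lee_fin -E normc_le_lpnorm.
Qed.

Lemma lpnorm_dominated p c x y : 0 < p -> 0 <= c ->
  (forall k, normc (x k) <= c * normc (y k)) ->
  (lpnorm p y <= 1)%E -> (lpnorm p x <= c%:E)%E.
Proof.
move=> p0 c0 xy; rewrite !lpnorm_leE// powR1 => h.
apply: (@le_trans _ _ ((c `^ p)%:E * \sum_(0 <= k <oo) (normc (y k) `^ p)%:E)%E).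
  rewrite -nneseriesZl; last by move=> k _; rewrite lee_fin powR_ge0.
  apply: lee_nneseries => [k _ _|k _]; first by rewrite lee_fin powR_ge0.
  rewrite -EFinM lee_fin -powRM ?normc_ge0//.
  by apply: ge0_ler_powR; rewrite ?(ltW p0) ?nnegrE ?mulr_ge0 ?normc_ge0.
by rewrite -[leRHS]mule1; apply: lee_wpmul2l => //; rewrite lee_fin powR_ge0.
Qed.

Definition spike c : cseq R := fun k => if k is 0 then (c%:C)%C else 0.

Lemma lpnorm_spike_le p c : 0 < p -> (lpnorm p (spike c) <= `|c|%:E)%E.
Proof.
move=> p0; rewrite lpnorm_leE// nneseries_recl//; last first.
  by move=> k _; rewrite lee_fin powR_ge0.
rewrite [spike c 0%N]/= normc_real eseries0 ?adde0// => -[|k]// _ _.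
by rewrite /spike ComplexField.Normc.normc0 powR0// gt_eqF.
Qed.

Context (q : R) (q1 : 1 <= q).

Let q0 : 0 < q. Proof. exact: lt_le_trans q1. Qed.

Fact spike_ell_pred c : spike c \in ell_pred q1.
Proof. by rewrite inE (le_lt_trans (lpnorm_spike_le _ _))// ltry. Qed.

Definition ell_spike c : ell q1 := Ell (spike_ell_pred c).

(** The preimage under the diagonal operator has the entry c / t 0. *)
Lemma class_W_spike (t : nat -> R) c : 0 < t 0%N -> `|c| <= t 0%N ->
  class_W q1 t (ell_spike c).
Proof.
move=> t0 ct; exists (ell_spike (c / t 0%N)).
  apply: le_trans (lpnorm_spike_le _ _) _ => //.
  by rewrite lee_fin normrM normfV (gtr0_norm t0) ler_pdivrMr// mul1r.
apply/funext => -[|k]; rewrite /diag_op /=; last by rewrite mulr0.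
by rewrite -[RHS]rmorphM/= mulrCA divff ?mulr1// gt_eqF.
Qed.

(** The noise opposite to a spike erases it, so the observation 0 tells nothing
    about the sign of c. *)
Lemma info_ball_spike0 p eps c : 0 < p -> `|c| <= eps ->
  info_ball q1 p eps (ell_spike c) 0.
Proof.
move=> p0 ce; exists (spike (- c)).
  apply: le_trans (lpnorm_spike_le _ _) _ => //.
  by rewrite lee_fin normrN.
apply/funext => k; change (0 = spike c k + spike (- c) k).
by case: k => [|k] /=; rewrite ?addr0// -[RHS]rmorphD/= subrr.
Qed.

(** A method gives the same answer to the observation 0 whether the unknown
    element is the spike of height c or its opposite.  Reading the error in
    coordinate 0 only reduces the claim to the triangle inequality in the
    complex plane. *)
Lemma optimal_error_ge (t : nat -> R) p eps c :
  0 < p -> 0 < t 0%N -> 0 <= c -> c <= eps -> c <= t 0%N ->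
  (c%:E <= optimal_error (class_W q1 t) (info_ball q1 p eps))%E.
Proof.
move=> p0 t0 c0 ce ct; apply/ereal_infP => _ [Phi _ <-].
set z := (Phi 0 : cseq R) 0%N.
have bound d : `|d| = c ->
    ((normc ((d%:C)%C - z))%:E <=
      method_error (class_W q1 t) (info_ball q1 p eps) Phi)%E.
  move=> dc; apply: le_trans (@normc_le_lpnorm q (ell_spike d - Phi 0) 0 q0) _.
  apply: ereal_sup_ubound; exists (ell_spike d); split.
    by apply: class_W_spike; rewrite ?dc.
  by exists 0; split => //; apply: info_ball_spike0; rewrite ?dc.
have b1 := bound c (ger0_norm c0).
have b2 : ((normc (((- c)%:C)%C - z))%:E <=
    method_error (class_W q1 t) (info_ball q1 p eps) Phi)%E.
  by apply: bound; rewrite normrN ger0_norm.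
have tri : 2 * c <= normc ((c%:C)%C - z) + normc (((- c)%:C)%C - z).
  rewrite -(normcN (((- c)%:C)%C - z)); apply: le_trans (le_normcD _ _).
  have -> : ((c%:C)%C - z) + - (((- c)%:C)%C - z) = ((2 * c)%:C)%C.
    rewrite rmorphN rmorphM/= rmorph_nat mulr_natl mulr2n.
    by rewrite opprD !opprK addrACA addNr addr0.
  by rewrite normc_real ler_norm.
have [h|h] := leP c (normc ((c%:C)%C - z)).
  by apply: le_trans b1; rewrite lee_fin.
apply: le_trans b2; rewrite lee_fin; lra.
Qed.

Lemma optimal_error_le (Z : lmodType R[i]) W (I : ell q1 -> set Z) Phi :
  (optimal_error W I <= method_error W I Phi)%E.
Proof. by apply: ereal_inf_lbound; exists Phi. Qed.

(** On a = x + y the identity errs by - y, independently of x. *)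
Lemma method_error_id_le W p eps : 0 < p -> p <= q ->
  (method_error W (info_ball q1 p eps) (fun a : ell q1 => a) <= eps%:E)%E.
Proof.
move=> p0 pq; apply/ereal_supP => _ [x [_ [a [[y yeps ay] ->]]]].
suff -> : lpnorm q (x - a : ell q1) = lpnorm q y.
  exact: le_trans (lpnorm_anti _ p0 pq) yeps.
rewrite !lpnormE//; congr (_ `^ _)%E; apply: eq_eseriesr => k _.
have -> : (x - a : ell q1) k = - y k :> R[i].
  by change (x k - a k = - y k); rewrite ay opprD addNKr.
by rewrite normcN.
Qed.

(** The zero method ignores its data, hence the arbitrary information I. *)
Lemma method_error_zero_le (t : nat -> R) (I : ell q1 -> set (ell q1)) :
  (forall k, 0 < t k) -> nonincreasing_seq t ->
  (method_error (class_W q1 t) I (fun=> 0%R) <= (t 0%N)%:E)%E.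
Proof.
move=> t0 tdec; apply/ereal_supP => _ [x [[h h1 xh] [a [_ ->]]]].
rewrite subr0; apply: lpnorm_dominated h1 => // [|k]; first exact: ltW.
rewrite xh ComplexField.Normc.normcM normc_real gtr0_norm//.
by rewrite ler_wpM2r ?normc_ge0 ?tdec.
Qed.

End SequenceNorms.

Theorem theorem6 (R : realType) (t : nat -> R)
    (t_gt0 : forall k, 0 < t k) (t_noninc : nonincreasing_seq t)
    (q : R) (q1 : 1 <= q) (p : R) (p_gt0 : 0 < p) (p_le_q : p <= q) (eps : R) :
  let W := class_W q1 t in
  let I := info_ball q1 p eps in
  (0 <= eps <= t 0%N ->
     optimal_error W I = method_error W I (fun a : ell q1 => a) /\
     method_error W I (fun a : ell q1 => a) = eps%:E) /\
  (t 0%N < eps ->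
     optimal_error W I = method_error W I (fun _ : ell q1 => 0 : ell q1) /\
     method_error W I (fun _ : ell q1 => 0 : ell q1) = (t 0%N)%:E).
Proof.
move=> W I.
have squeeze (Phi : ell q1 -> ell q1) c :
    (c%:E <= optimal_error W I)%E -> (method_error W I Phi <= c%:E)%E ->
    optimal_error W I = method_error W I Phi /\ method_error W I Phi = c%:E.
  move=> lo up; have mid := optimal_error_le W I Phi.
  have E : method_error W I Phi = c%:E.
    by apply/eqP; rewrite eq_le up (le_trans lo mid).
  by split=> //; apply/eqP; rewrite eq_le mid E lo.
split=> [/andP[e0 et]|te]; apply: squeeze.
- exact: optimal_error_ge.
- exact: method_error_id_le.
- by apply: optimal_error_ge => //; exact: ltW.
- exact: method_error_zero_le.
Qed.
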